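(* Let $x,y$ be noncommuting invertible variables with $yx=qxy$. Then for all integers $n$ and $k$, $\binom{n}{k}_q = \{x^ky^{n-k}\}(x+y)^n.$
   Context: For an integer $n\ge 0$, $(a;q)_n=\prod_{j=0}^{n-1}(1-aq^j)$, and for $n<0$, $(a;q)_n=\prod_{j=1}^{|n|}\frac{1}{1-aq^{-j}}$. For all integers $n,k$, $\binom{n}{k}_q := \lim_{a\to q} \frac{(a;q)_n}{(a;q)_k\,(a;q)_{n-k}}$ (a Laurent polynomial in $q$). Coefficient extraction: for $n\ge0$, $(x+y)^n$ is a noncommutative polynomial which, using $yx=qxy$, is written uniquely as $\sum_k c_k x^ky^{n-k}$, and $\{x^ky^{n-k}\}(x+y)^n:=c_k$. For $n<0$, $(x+y)^n$ can be expanded in two ways. First, writing $(x+y)^{-1}=y^{-1}(1+xy^{-1})^{-1}=y^{-1}\sum_{j\ge0}(-1)^j(xy^{-1})^j$ and taking the $|n|$-th power, then normal ordering with $yx=qxy$, gives $(x+y)^n=\sum_{k\ge0}a_kx^ky^{n-k}$. Second, writing $(x+y)^{-1}=(1+x^{-1}y)^{-1}x^{-1}=\sum_{j\ge0}(-1)^j(x^{-1}y)^jx^{-1}$, taking the $|n|$-th power and normal ordering gives $(x+y)^n=\sum_{k\le n}b_kx^ky^{n-k}$. Then $\{x^ky^{n-k}\}(x+y)^n:=a_k$ if $k\ge0$ and $:=b_k$ if $k<0$. (For $n\ge 0$ both expansions coincide with the polynomial.) *)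

(* Defs.v *)
From HB Require Import structures.
From mathcomp Require Import all_boot all_order all_algebra.
From mathcomp Require Import all_classical.
From mathcomp Require Import ring zify.

Set Implicit Arguments.
Unset Strict Implicit.
Unset Printing Implicit Defensive.
Import Order.TTheory GRing.Theory Num.Theory.
Local Open Scope classical_set_scope.
Local Open Scope ring_scope.

Local Notation "x %:F" := (@FracField.tofrac _ x).

(* [tends_to f c l]: the rational function f, in one indeterminate over K, is
   regular at c with value l there, i.e. lim_{a -> c} f(a) = l. K may be a
   field of formal rational functions, where no analytic limit exists. *)
Definition tends_to (K : fieldType) (f : {fraction {poly K}}) (c l : K) : Prop :=
  exists P Q : {poly K},
    [/\ Q.[c] != 0, f = P%:F / Q%:F & l = P.[c] / Q.[c]].

(* Defaults to 0 when the limit does not exist; see [qbinom_tends_to]. *)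
Definition rat_lim (K : fieldType) (f : {fraction {poly K}}) (c : K) : K :=
  xget 0 [set l | tends_to f c l].

(* Recall that Negz m is the integer - m.+1. *)
Definition qpoch (F : fieldType) (a q : F) (n : int) : F :=
  match n with
  | Posz m => \prod_(0 <= j < m) (1 - a * q ^+ j)
  | Negz m => \prod_(1 <= j < m.+2) (1 - a * q ^- j)^-1
  end.

(* The limit is taken in a, the indeterminate of {fraction {poly K}}. *)
Definition qbinom (K : fieldType) (q : K) (n k : int) : K :=
  let a := ('X : {poly K})%:F in
  let q' := q%:P%:F in
  rat_lim (qpoch a q' n / (qpoch a q' k * qpoch a q' (n - k))) q.

(* A function f : int * int -> K stands for the formal series
   sum_(k, l) f (k, l) x^k y^l of normally ordered monomials. Since
   x^k y^l x^k' y^l' = q^(l k') x^(k+k') y^(l+l'), the coefficient of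
   x^(s.1) y^(s.2) in a product is as below. The sum is the finitely supported
   sum of the library, equal to 0 if the support is infinite: as for any
   product of two-sided series, only supports that meet each monomial finitely
   often are meaningful. Beware that [*] and [^+] on functions are pointwise. *)
Definition qmul (K : fieldType) (q : K) (f g : int * int -> K) : int * int -> K :=
  fun s => \sum_(t \in [set: int * int])
    f t * g (s - t) * q ^ (t.2 * (s.1 - t.1)).

Definition qmono (K : fieldType) (u : int * int) : int * int -> K :=
  fun s => (s == u)%:R.

Definition qexp (K : fieldType) (q : K) (f : int * int -> K) (m : nat) :
    int * int -> K :=
  iter m (qmul q f) (qmono K (0, 0)).

(* sum_(j >= 0) (-1)^j f^j, summed coefficientwise *)
Definition alt_geom (K : fieldType) (q : K) (f : int * int -> K) :
    int * int -> K :=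
  fun s => \sum_(j \in [set: nat]) (-1) ^+ j * qexp q f j s.

Definition qx (K : fieldType) : int * int -> K := qmono K (1, 0).
Definition qy (K : fieldType) : int * int -> K := qmono K (0, 1).
Definition qxV (K : fieldType) : int * int -> K := qmono K (- 1, 0).
Definition qyV (K : fieldType) : int * int -> K := qmono K (0, - 1).

(* (x + y)^-1 = y^-1 (1 + x y^-1)^-1, expanded in nonnegative powers of x *)
Definition inv_xy_up (K : fieldType) (q : K) : int * int -> K :=
  qmul q (qyV K) (alt_geom q (qmul q (qx K) (qyV K))).

(* (x + y)^-1 = (1 + x^-1 y)^-1 x^-1, expanded in negative powers of x *)
Definition inv_xy_down (K : fieldType) (q : K) : int * int -> K :=
  qmul q (alt_geom q (qmul q (qxV K) (qy K))) (qxV K).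

Definition xy_pow_up (K : fieldType) (q : K) (n : int) : int * int -> K :=
  match n with
  | Posz m => qexp q (qx K + qy K) m
  | Negz m => qexp q (inv_xy_up q) m.+1
  end.

Definition xy_pow_down (K : fieldType) (q : K) (n : int) : int * int -> K :=
  match n with
  | Posz m => qexp q (qx K + qy K) m
  | Negz m => qexp q (inv_xy_down q) m.+1
  end.

(* {x^k y^(n-k)} (x + y)^n *)
Definition xy_coef (K : fieldType) (q : K) (n k : int) : K :=
  if 0 <= k then xy_pow_up q n (k, n - k) else xy_pow_down q n (k, n - k).

(* The indeterminate q of the field of rational functions Q(q). *)
Definition qvar : {fraction {poly rat}} := ('X : {poly rat})%:F.

Lemma tends_to_unique (K : fieldType) (f : {fraction {poly K}}) (c l l' : K) :
  tends_to f c l -> tends_to f c l' -> l = l'.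
Proof.
move=> [P [Q [Qc fE ->]]] [P' [Q' [Q'c fE' ->]]].
have Q0 : Q != 0 by apply: contraNneq Qc => ->; rewrite horner0.
have Q'0 : Q' != 0 by apply: contraNneq Q'c => ->; rewrite horner0.
have /eqP : P%:F / Q%:F = P'%:F / Q'%:F by rewrite -fE -fE'.
rewrite eqr_div ?tofrac_eq0// -!tofracM tofrac_eq => /eqP/(congr1 (horner^~ c)).
by rewrite !hornerM => E; apply/eqP; rewrite eqr_div// E.
Qed.

Lemma tends_to_poly (K : fieldType) (P : {poly K}) (c : K) :
  tends_to P%:F c P.[c].
Proof. by exists P, 1; rewrite hornerC tofrac1 !divr1 oner_eq0. Qed.

Lemma tends_toM (K : fieldType) (f g : {fraction {poly K}}) (c l m : K) :
  tends_to f c l -> tends_to g c m -> tends_to (f * g) c (l * m).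
Proof.
move=> [P [Q [Qc -> ->]]] [P' [Q' [Q'c -> ->]]].
exists (P * P'), (Q * Q'); split; first by rewrite hornerM mulf_neq0.
- by rewrite !tofracM mulf_div.
- by rewrite !hornerM mulf_div.
Qed.

Lemma tends_toV (K : fieldType) (f : {fraction {poly K}}) (c l : K) :
  l != 0 -> tends_to f c l -> tends_to f^-1 c l^-1.
Proof.
move=> l0 [P [Q [Qc -> lE]]]; exists Q, P; split.
- by apply: contraNneq l0 => Pc; rewrite lE Pc mul0r.
- by rewrite invf_div.
- by rewrite lE invf_div.
Qed.

Lemma tends_to_prod (K : fieldType) (F : nat -> {fraction {poly K}}) (c : K)
    (m n : nat) :
  (forall j, (m <= j)%N -> exists2 l, l != 0 & tends_to (F j) c l) ->
  exists2 l, l != 0 & tends_to (\prod_(m <= j < n) F j) c l.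
Proof.
move=> HF; rewrite big_nat; elim/big_ind: _ => [|f g [l l0 fl] [k k0 gk]|j].
- by exists 1; rewrite ?oner_neq0//; have := tends_to_poly 1 c; rewrite hornerC.
- by exists (l * k); [exact: mulf_neq0 | exact: tends_toM].
- by move=> /andP[mj _]; exact: HF.
Qed.

(* At a = q, the only zero or pole of (a; q)_n is a simple pole for n < 0. *)
Lemma qpoch_tends_to (K : fieldType) (q : K) (n : int) :
  q != 0 -> (forall m : nat, q ^+ m.+1 != 1) ->
  exists2 l, l != 0 &
    tends_to (qpoch 'X%:F q%:P%:F n * (1 - 'X%:F / q%:P%:F) ^+ (n < 0)%R) q l.
Proof.
move=> q0 qroot; have fac (b : K) :
    1 - q * b != 0 ->
    exists2 l, l != 0 & tends_to (1 - 'X%:F * b%:P%:F) q l.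
  exists (1 - q * b) => //; have := tends_to_poly (1 - 'X * b%:P) q.
  by rewrite !hornerE tofracB tofracM tofrac1.
have qV : (q%:P%:F)^-1 = (q^-1)%:P%:F :> {fraction {poly K}}.
  apply: (mulfI (x := q%:P%:F)); first by rewrite tofrac_eq0 polyC_eq0.
  by rewrite divff ?tofrac_eq0 ?polyC_eq0// -tofracM -polyCM divff// tofrac1.
case: n => m /=.
  rewrite mulr1; apply: tends_to_prod => j _.
  rewrite -tofracXn -polyC_exp; apply: fac.
  by rewrite -exprS subr_eq0 eq_sym.
have q1 : 1 - 'X%:F / q%:P%:F != 0 :> {fraction {poly K}}.
  rewrite subr_eq0 qV -tofracM -tofrac1 tofrac_eq; apply/eqP.
  move/(congr1 (horner^~ 0)); rewrite hornerM hornerX hornerC mul0r => /eqP.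
  by rewrite oner_eq0.
rewrite big_ltn// expr1 mulrAC mulVf// mul1r; apply: tends_to_prod => j j1.
have [|l l0 Hl] := @fac (q ^- j).
  case: j j1 => [//|[//|j]] _.
  rewrite exprS invfM mulrA divff// mul1r subr_eq0 eq_sym invr_eq1.
  exact: qroot.
exists l^-1; first by rewrite invr_eq0.
rewrite -exprVn qV -tofracXn -polyC_exp exprVn.
exact: tends_toV.
Qed.

Lemma pole_order_split (F : fieldType) (n k m u : F) (a b c : nat) :
  u != 0 -> (c <= a + b)%N ->
  n / (k * m) = n * u ^+ c * (k * u ^+ a * (m * u ^+ b))^-1 * u ^+ (a + b - c).
Proof.
move=> u0 le; rewrite mulrACA -exprD -{1}(subnK le) exprD.
move: (u ^+ (a + b - c)) (u ^+ c) (expf_neq0 (a + b - c) u0) (expf_neq0 c u0).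
move=> v w v0 w0; rewrite [(k * m * _)^-1]invfM; move: (k * m)^-1 => d.
by field; rewrite v0 w0.
Qed.

Lemma qbinom_tends_to (K : fieldType) (q : K) (n k : int) :
  q != 0 -> (forall m : nat, q ^+ m.+1 != 1) ->
  let a := ('X : {poly K})%:F in
  let q' := q%:P%:F in
  tends_to (qpoch a q' n / (qpoch a q' k * qpoch a q' (n - k))) q (qbinom q n k).
Proof.
move=> q0 qroot a q'; set f := (X in tends_to X).
suff ex : exists l, tends_to f q l by exact: (xgetPex 0 ex).
have [ln ln0 Hn] := qpoch_tends_to n q0 qroot.
have [lk lk0 Hk] := qpoch_tends_to k q0 qroot.
have [lm lm0 Hm] := qpoch_tends_to (n - k) q0 qroot.
rewrite -/a -/q' in Hn Hk Hm; set u := 1 - a / q' in Hn Hk Hm.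
have Hu (e : nat) : exists l, tends_to (u ^+ e) q l.
  have q'V : q'^-1 = (q^-1)%:P%:F.
    apply: (mulfI (x := q')); first by rewrite tofrac_eq0 polyC_eq0.
    by rewrite divff ?tofrac_eq0 ?polyC_eq0// -tofracM -polyCM divff// tofrac1.
  exists ((1 - 'X * (q^-1)%:P) ^+ e).[q].
  have := tends_to_poly ((1 - 'X * (q^-1)%:P) ^+ e) q.
  by rewrite tofracXn tofracB tofracM tofrac1 -q'V.
have u0 : u != 0.
  rewrite subr_eq0; apply/eqP => /(congr1 (fun z => z * q')).
  rewrite mul1r divfK ?tofrac_eq0 ?polyC_eq0// => /eqP.
  rewrite tofrac_eq => /eqP /(congr1 (fun p : {poly K} => p`_1)).
  by rewrite coefX coefC /= => /eqP; rewrite eq_sym oner_eq0.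
have le : ((n < 0)%R <= (k < 0)%R + (n - k < 0)%R)%N.
  by case: (ltP n 0); case: (ltP k 0); case: (ltP (n - k) 0) => //; lia.
have [l Hl] := Hu ((k < 0)%R + (n - k < 0)%R - (n < 0)%R)%N.
exists (ln * (lk * lm)^-1 * l).
rewrite /f (pole_order_split _ _ _ u0 le).
apply: tends_toM => //; apply: tends_toM => //; apply: tends_toV.
  exact: mulf_neq0.
exact: tends_toM.
Qed.

Lemma qvar_neq0 : qvar != 0.
Proof. by rewrite tofrac_eq0 polyX_eq0. Qed.

Lemma qvar_expS_neq1 (m : nat) : qvar ^+ m.+1 != 1.
Proof.
rewrite -tofracXn -tofrac1 tofrac_eq; apply/eqP => /(congr1 (horner^~ 0)).
by rewrite hornerXn expr0n /= hornerC => /eqP; rewrite eq_sym oner_eq0.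
Qed.

Lemma fsum_single (K : fieldType) (T : choiceType) (t0 : T) (F : T -> K) :
  (forall t, t != t0 -> F t = 0) -> \sum_(t \in [set: T]) F t = F t0.
Proof.
move=> F0; rewrite -(@fsbig_widen _ _ _ _ [set t0]) ?fsbig_set1//.
by move=> t [_ /= /eqP]; exact: F0.
Qed.

Lemma qmul_monol (K : fieldType) (q : K) (u : int * int) (g : int * int -> K)
    (s : int * int) :
  qmul q (qmono K u) g s = g (s - u) * q ^ (u.2 * (s.1 - u.1)).
Proof.
rewrite /qmul (fsum_single (t0 := u)) /qmono ?eqxx ?mul1r// => t /negPf ->.
by rewrite !mul0r.
Qed.

Lemma qmul_monor (K : fieldType) (q : K) (f : int * int -> K) (u s : int * int) :
  qmul q f (qmono K u) s = f (s - u) * q ^ ((s.2 - u.2) * u.1).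
Proof.
have E t : s - t == u = (t == s - u).
  by rewrite subr_eq [u + t]addrC -subr_eq eq_sym.
rewrite /qmul (fsum_single (t0 := s - u)) /qmono.
  by rewrite E eqxx mulr1; congr (_ * _ ^ (_ * _)); rewrite /= opprB addrC subrK.
by move=> t; rewrite E => /negPf->; rewrite mulr0 mul0r.
Qed.

Lemma qmono_mul (K : fieldType) (q : K) (u v : int * int) :
  qmul q (qmono K u) (qmono K v) =
  (fun s => q ^ (u.2 * v.1) * qmono K (u + v) s).
Proof.
apply/funext => s; rewrite qmul_monol /qmono subr_eq [v + u]addrC.
rewrite [RHS]mulrC; case: eqP => [->|_]; last by rewrite !mul0r.
by rewrite [(u + v).1]/= [u.1 + _]addrC addrK.
Qed.

(* The defining relation y x = q x y. *)
Lemma qy_qx (K : fieldType) (q : K) :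
  qmul q (qy K) (qx K) = (fun s => q * qmul q (qx K) (qy K) s).
Proof.
by rewrite !qmono_mul; apply/funext => s /=; rewrite !expr0z !expr1z mul1r.
Qed.

Lemma qx_qxV (K : fieldType) (q : K) :
  qmul q (qx K) (qxV K) = qmono K (0, 0) /\
  qmul q (qxV K) (qx K) = qmono K (0, 0).
Proof. by split; rewrite qmono_mul; apply/funext => s /=; rewrite expr0z mul1r. Qed.

Lemma qy_qyV (K : fieldType) (q : K) :
  qmul q (qy K) (qyV K) = qmono K (0, 0) /\
  qmul q (qyV K) (qy K) = qmono K (0, 0).
Proof. by split; rewrite qmono_mul; apply/funext => s /=; rewrite expr0z mul1r. Qed.

Lemma fsumD_single (K : fieldType) (T : choiceType) (t1 t2 : T) (F G : T -> K) :
  (forall t, t != t1 -> F t = 0) -> (forall t, t != t2 -> G t = 0) ->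
  \sum_(t \in [set: T]) (F t + G t) = F t1 + G t2.
Proof.
move=> F0 G0; set A := [set t1; t2].
have finA : finite_set A by rewrite finite_setU; split; exact: finite_set1.
have AF t : ~ A t -> t != t1 /\ t != t2.
  by move=> /not_orP[] /= /eqP ? /eqP ?.
rewrite -(fsum_single F0) -(fsum_single G0).
rewrite -!(@fsbig_widen _ _ _ _ A setT) ?fsbig_split//.
- by move=> t [_ /AF[_ /G0]].
- by move=> t [_ /AF[/F0]].
- by move=> t [_ /AF[/F0 /= -> /G0 ->]]; rewrite addr0.
Qed.

Lemma qmul_addl (K : fieldType) (q : K) (u v : int * int) (g : int * int -> K)
    (s : int * int) :
  qmul q (qmono K u + qmono K v) g s =
  qmul q (qmono K u) g s + qmul q (qmono K v) g s.
Proof.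
have E w t : t != w -> qmono K w t * g (s - t) * q ^ (t.2 * (s.1 - t.1)) = 0.
  by rewrite /qmono => /negPf ->; rewrite !mul0r.
rewrite {2 3}/qmul !(fsum_single (E _)) -(fsumD_single (E u) (E v)).
by apply: eq_fsbigr => t _; rewrite -!mulrDl.
Qed.

Lemma qmul_addr (K : fieldType) (q : K) (u v : int * int) (f : int * int -> K)
    (s : int * int) :
  qmul q f (qmono K u + qmono K v) s =
  qmul q f (qmono K u) s + qmul q f (qmono K v) s.
Proof.
have E w t : t != s - w -> f t * qmono K w (s - t) * q ^ (t.2 * (s.1 - t.1)) = 0.
  rewrite /qmono eq_sym subr_eq addrC -subr_eq => /negPf ->.
  by rewrite mulr0 mul0r.
rewrite {2 3}/qmul !(fsum_single (E _)) -(fsumD_single (E u) (E v)).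
by apply: eq_fsbigr => t _; rewrite -mulrDl -mulrDr.
Qed.

Lemma qexp_mono_off (K : fieldType) (q : K) (u s : int * int) (j : nat) :
  s != u *+ j -> qexp q (qmono K u) j s = 0.
Proof.
elim: j s => [|j IH] s.
  by rewrite mulr0n /qexp /= /qmono => /negPf ->.
rewrite /qexp iterS -/(qexp _ _ _) qmul_monol mulrSr -subr_eq => /IH ->.
by rewrite mul0r.
Qed.

Lemma mulrn_pair (u : int * int) (m : nat) : u *+ m = (u.1 *+ m, u.2 *+ m).
Proof. by elim: m => // m IH; rewrite !mulrS IH. Qed.

Lemma mulrn_pair_inj (u : int * int) (i j : nat) :
  u.1 != 0 -> u *+ i = u *+ j -> i = j.
Proof.
move=> u0 /(congr1 fst); rewrite !mulrn_pair /= => /(mulrIn u0).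
exact.
Qed.

Lemma alt_geom_mono (K : fieldType) (q : K) (u : int * int) (j : nat) :
  u.1 != 0 ->
  alt_geom q (qmono K u) (u *+ j) = (-1) ^+ j * qexp q (qmono K u) j (u *+ j).
Proof.
move=> u0; rewrite /alt_geom (fsum_single (t0 := j))// => i ij.
rewrite qexp_mono_off ?mulr0//; apply: contra_neq ij => E.
exact/esym/(mulrn_pair_inj u0 E).
Qed.

Lemma alt_geom_mono_off (K : fieldType) (q : K) (u s : int * int) :
  (forall j, s != u *+ j) -> alt_geom q (qmono K u) s = 0.
Proof.
move=> su; rewrite /alt_geom fsbig1// => j _.
by rewrite qexp_mono_off ?mulr0.
Qed.

Lemma alt_geomE (K : fieldType) (q : K) (u s : int * int) : u.1 != 0 ->
  alt_geom q (qmono K u) s + qmul q (qmono K u) (alt_geom q (qmono K u)) s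
  = qmono K (0, 0) s.
Proof.
move=> u0; rewrite qmul_monol.
have [[j ->]|] := pselect (exists j, s = u *+ j); last first.
  move=> /forallNP su; rewrite !alt_geom_mono_off ?mul0r ?addr0.
  - by rewrite /qmono; case: eqP => // s0; case: (su 0); rewrite s0 mulr0n.
  - move=> j; apply/eqP => /(congr1 (+%R u)); rewrite addrC subrK -mulrS.
    exact: su.
  - by move=> j; apply/eqP/su.
case: j => [|j].
  rewrite alt_geom_mono// alt_geom_mono_off ?mul0r ?addr0 ?expr0 ?mul1r//.
  move=> j; apply/eqP => /(congr1 (+%R u)); rewrite addrC subrK -mulrS.
  by move/(mulrn_pair_inj u0).
rewrite {2}mulrSr addrK !alt_geom_mono// /qexp iterS -/(qexp _ _ _) qmul_monol.
rewrite [in X in X + _]mulrSr addrK exprS mulN1r mulNr mulrA mulrSr addNr.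
rewrite /qmono; case: eqP => //; rewrite -mulrSr => E.
by have := @mulrn_pair_inj u j.+1 0 u0 E.
Qed.

Lemma alt_geomEr (K : fieldType) (q : K) (u s : int * int) : u.1 != 0 ->
  alt_geom q (qmono K u) s + qmul q (alt_geom q (qmono K u)) (qmono K u) s
  = qmono K (0, 0) s.
Proof.
move=> u0; rewrite -(alt_geomE q s u0) qmul_monol qmul_monor.
have [[j sj]|/forallNP su] := pselect (exists j, s - u = u *+ j); last first.
  by rewrite (@alt_geom_mono_off _ q u (s - u)) ?mul0r// => j; apply/eqP/su.
congr (_ + _ * _ ^ _).
rewrite -[s.2 - u.2]/((s - u).2) -[s.1 - u.1]/((s - u).1) sj.
by rewrite !mulrn_pair mulrnAl mulrnAr.
Qed.

Lemma qmul_mono_monol (K : fieldType) (q : K) (u v : int * int)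
    (g : int * int -> K) (s : int * int) : q != 0 ->
  qmul q (qmono K u) (qmul q (qmono K v) g) s =
  q ^ (u.2 * v.1) * qmul q (qmono K (u + v)) g s.
Proof.
move=> q0; rewrite !qmul_monol opprD addrA -mulrA [RHS]mulrCA; congr (_ * _).
by rewrite -!expfzDr//; congr (_ ^ _); rewrite /=; ring.
Qed.

Lemma qmul_mono_monor (K : fieldType) (q : K) (u v : int * int)
    (f : int * int -> K) (s : int * int) : q != 0 ->
  qmul q (qmul q f (qmono K u)) (qmono K v) s =
  q ^ (u.2 * v.1) * qmul q f (qmono K (u + v)) s.
Proof.
move=> q0; rewrite !qmul_monor opprD [- u - v]addrC addrA -mulrA [RHS]mulrCA.
by congr (_ * _); rewrite -!expfzDr//; congr (_ ^ _); rewrite /=; ring.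
Qed.

Lemma qx_qyV_mul (K : fieldType) (q : K) :
  qmul q (qx K) (qyV K) = qmono K (1, - 1).
Proof.
by rewrite qmono_mul; apply/funext => s /=; rewrite mul0r expr0z mul1r.
Qed.

Lemma qxV_qy_mul (K : fieldType) (q : K) :
  qmul q (qxV K) (qy K) = qmono K (- 1, 1).
Proof.
by rewrite qmono_mul; apply/funext => s /=; rewrite mul0r expr0z mul1r.
Qed.

(* The two expansions of (x + y)^-1 are indeed inverses of x + y. *)
Lemma inv_xy_upP (K : fieldType) (q : K) : q != 0 ->
  qmul q (qx K + qy K) (inv_xy_up q) = qmono K (0, 0).
Proof.
move=> q0; apply/funext => s; rewrite qmul_addl /inv_xy_up qx_qyV_mul.
rewrite !qmul_mono_monol// -(@alt_geomE _ q (1, - 1))// addrC.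
rewrite mul0r mulr0 !expr0z !mul1r; congr (_ + _).
by rewrite qmul_monol /= mul0r expr0z mulr1 subr0.
Qed.

Lemma inv_xy_downP (K : fieldType) (q : K) : q != 0 ->
  qmul q (inv_xy_down q) (qx K + qy K) = qmono K (0, 0).
Proof.
move=> q0; apply/funext => s; rewrite qmul_addr /inv_xy_down qxV_qy_mul.
rewrite !qmul_mono_monor// -(@alt_geomEr _ q (- 1, 1))//.
rewrite !mul0r !expr0z !mul1r; congr (_ + _).
by rewrite qmul_monor /= mulr0 expr0z mulr1 subr0.
Qed.

(* f is homogeneous of degree d in (x, y), and only powers x^k with k >= c
   (for e = 1), resp. k <= c (for e = -1), occur in it. All the infinite
   series above are of this form, and products of such series are well
   defined. *)
Definition hom_from (K : fieldType) (e c d : int) (f : int * int -> K) : Prop :=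
  forall t, f t != 0 -> 0 <= e * (t.1 - c) /\ t.1 + t.2 = d.

Lemma qmul_finite_support (K : fieldType) (q : K) (e c c' d d' : int)
    (f g : int * int -> K) (s : int * int) : (e = 1) \/ (e = - 1) ->
  hom_from e c d f -> hom_from e c' d' g ->
  finite_set [set t | f t * g (s - t) * q ^ (t.2 * (s.1 - t.1)) != 0].
Proof.
move=> e1 Hf Hg.
pose h (j : nat) : int * int := (c + e * j%:Z, d - (c + e * j%:Z)).
have fin := finite_image h (finite_II (absz (s.1 - c - c')%R).+1).
refine (sub_finite_set _ fin).
move=> [t1 t2] /=; rewrite -mulrA mulf_eq0 negb_or mulf_eq0 negb_or.
case/and3P=> /Hf[/= ft td] /Hg[/= gt _] _.
exists (absz (t1 - c)%R); first by rewrite /=; case: e1 ft gt => ->; lia.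
by rewrite /h; congr (_, _); case: e1 ft gt => ->; lia.
Qed.

Lemma qmul_hom_from (K : fieldType) (q : K) (e c c' d d' : int)
    (f g : int * int -> K) :
  hom_from e c d f -> hom_from e c' d' g ->
  hom_from e (c + c') (d + d') (qmul q f g).
Proof.
move=> Hf Hg s; apply: contra_neqP => Hs; rewrite /qmul fsbig1// => t _.
have [->|/Hf[ft td]] := eqVneq (f t) 0; first by rewrite !mul0r.
have [->|/Hg[gt sd]] := eqVneq (g (s - t)) 0; first by rewrite mulr0 mul0r.
case: Hs; move: s t ft td gt sd => [s1 s2] [t1 t2] /= ft td gt sd; split; last lia.
rewrite (_ : s1 - (c + c') = (t1 - c) + (s1 - t1 - c')); last by ring.
by rewrite mulrDr addr_ge0.
Qed.

Lemma qexp_hom_from (K : fieldType) (q : K) (e c d : int)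
    (f : int * int -> K) (m : nat) :
  hom_from e c d f -> hom_from e (c *+ m) (d *+ m) (qexp q f m).
Proof.
move=> Hf; elim: m => [|m IH].
  move=> s; rewrite /qexp /= /qmono; case: (s =P (0, 0)) => [->|_]; last by rewrite eqxx.
  by rewrite !mulr0n /= subr0 mulr0.
by rewrite /qexp iterS !mulrS; exact: qmul_hom_from.
Qed.

Lemma qmono_hom_from (K : fieldType) (e : int) (u : int * int) :
  hom_from e u.1 (u.1 + u.2) (qmono K u).
Proof.
move=> s; rewrite /qmono; case: (s =P u) => [->|_]; last by rewrite eqxx.
by rewrite subrr mulr0.
Qed.

Lemma alt_geom_hom_from (K : fieldType) (q : K) (e : int) (u : int * int) :
  0 <= e * u.1 -> u.1 + u.2 = 0 -> hom_from e 0 0 (alt_geom q (qmono K u)).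
Proof.
move=> eu du s; apply: contra_neqP => Hs; rewrite alt_geom_mono_off// => j.
apply: contra_notN Hs => /eqP->; rewrite mulrn_pair /= subr0 mulrnAr.
by rewrite mulrn_wge0// -mulrnDl du mul0rn.
Qed.

(* In a negative power, only x^k y^(n - k) with k >= 0, resp. k <= n, occur. *)
Lemma xy_pow_up_hom_from (K : fieldType) (q : K) (n : int) :
  n < 0 -> hom_from 1 0 n (xy_pow_up q n).
Proof.
case: n => // m _; have := @qexp_hom_from K q 1 0 (- 1) (inv_xy_up q) m.+1.
rewrite mul0rn mulNrn NegzE natz => H; apply: H; rewrite /inv_xy_up qx_qyV_mul.
by apply: (@qmul_hom_from _ _ 1 0 0 (- 1) 0);
  [exact: qmono_hom_from | exact: alt_geom_hom_from].
Qed.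

Lemma xy_pow_down_hom_from (K : fieldType) (q : K) (n : int) :
  n < 0 -> hom_from (- 1) n n (xy_pow_down q n).
Proof.
case: n => // m _; have := @qexp_hom_from K q (- 1) (- 1) (- 1) (inv_xy_down q) m.+1.
rewrite mulNrn NegzE natz => H; apply: H; rewrite /inv_xy_down qxV_qy_mul.
by apply: (@qmul_hom_from _ _ (- 1) 0 (- 1) 0 (- 1));
  [exact: alt_geom_hom_from | exact: qmono_hom_from].
Qed.

(* Main.v *)
(* Both sides satisfy the two q-Pascal recurrences
     c(n+1,k) = c(n,k-1) + q^k c(n,k) = q^(n+1-k) c(n,k-1) + c(n,k).
   For the coefficients they express left and right multiplication by x + y
   and hold for each of the two expansions separately. For the q-binomials they
   hold for (n+1,k) <> (0,0), which suffices to go down from n = 0: for k >= 0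
   with the left recurrence, increasing k from c(n,0) = 1, and for k <= n < 0
   with the right one, decreasing k from c(n,n) = 1. For n < k < 0 both sides
   vanish. *)
Require Import Defs.
From mathcomp Require Import all_boot all_order all_algebra.
From mathcomp Require Import all_classical.
From mathcomp Require Import ring zify.

Set Implicit Arguments.
Unset Strict Implicit.
Unset Printing Implicit Defensive.
Import Order.TTheory GRing.Theory Num.Theory.
Local Open Scope classical_set_scope.
Local Open Scope ring_scope.

Local Notation "x %:F" := (@FracField.tofrac _ x).

(** * Limits of rational functions, and shifted factorials with generic base a *)

Lemma tends_toD (K : fieldType) (f g : {fraction {poly K}}) (c l m : K) :
  tends_to f c l -> tends_to g c m -> tends_to (f + g) c (l + m).
Proof.
have nz (Q : {poly K}) : Q.[c] != 0 -> Q%:F != 0.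
  by move=> Qc; rewrite tofrac_eq0; apply: contraNneq Qc => ->; rewrite horner0.
move=> [P [Q [Qc -> ->]]] [P' [Q' [Q'c -> ->]]].
exists (P * Q' + P' * Q), (Q * Q'); split; first by rewrite hornerM mulf_neq0.
- by rewrite tofracD !tofracM addf_div ?nz.
- by rewrite hornerD !hornerM addf_div.
Qed.

Lemma tends_to_polyC (K : fieldType) (b c : K) : tends_to b%:P%:F c b.
Proof. by have := tends_to_poly b%:P c; rewrite hornerC. Qed.

Lemma tofrac_polyCV (K : fieldType) (b : K) :
  (b^-1)%:P%:F = (b%:P%:F)^-1 :> {fraction {poly K}}.
Proof.
have [->|b0] := eqVneq b 0; first by rewrite invr0 tofrac0 invr0.
apply: (mulfI (x := b%:P%:F)); first by rewrite tofrac_eq0 polyC_eq0.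
by rewrite divff ?tofrac_eq0 ?polyC_eq0// -tofracM -polyCM divff// tofrac1.
Qed.

Lemma tofrac_polyCXz (K : fieldType) (b : K) (e : int) :
  (b ^ e)%:P%:F = (b%:P%:F) ^ e :> {fraction {poly K}}.
Proof.
case: e => m; first by rewrite -!exprnP polyC_exp tofracXn.
by rewrite NegzE -!exprnN tofrac_polyCV polyC_exp tofracXn.
Qed.

(** For [n < 0] the new factor cancels the last inverse of the product, whence the nonvanishing
    hypothesis. *)
Lemma qpochS (F : fieldType) (a q : F) (n : int) :
  (forall e : int, 1 - a * q ^ e != 0) ->
  qpoch a q (n + 1) = qpoch a q n * (1 - a * q ^ n).
Proof.
move=> nz; case: n => m.
  by rewrite (_ : Posz m + 1 = Posz m.+1) /= ?big_nat_recr//; lia.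
case: m => [|m].
  by rewrite /= big_geq// big_nat1 NegzE -exprnN mulVf// exprnN nz.
rewrite (_ : Negz m.+1 + 1 = Negz m); last by lia.
by rewrite /= [in RHS]big_nat_recr//= -mulrA NegzE -exprnN mulVf ?mulr1// exprnN nz.
Qed.

Lemma qpoch_neq0 (F : fieldType) (a q : F) (n : int) :
  (forall e : int, 1 - a * q ^ e != 0) -> qpoch a q n != 0.
Proof.
move=> nz; case: n => m /=; rewrite prodf_seq_neq0; apply/allP => j _ /=.
  exact: (nz j).
by rewrite invr_eq0 exprnN; exact: nz.
Qed.

(** At generic a the Pascal rule fails by a multiple of [1 - a / q], isolated here because it tends
    to 0 as a tends to q. *)
Lemma qpoch_pascal (F : fieldType) (a q : F) (n k : int) :
  q != 0 -> (forall e : int, 1 - a * q ^ e != 0) ->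
  let R n k := qpoch a q n / (qpoch a q k * qpoch a q (n - k)) in
  R (n + 1) k = R n (k - 1) + q ^ k * R n k -
    q ^ k * ((1 - a / q) * (qpoch a q n / (qpoch a q k * qpoch a q (n + 1 - k)))).
Proof.
move=> q0 nz /=; rewrite (_ : n - (k - 1) = n + 1 - k); last by ring.
have := qpochS (k - 1) nz; rewrite subrK => ->.
have := qpochS (n - k) nz; rewrite (_ : n - k + 1 = n + 1 - k); last by ring.
move=> ->; rewrite (qpochS n nz).
(* With the factorials reduced to the indices [k - 1], [n - k] and [n], writing all powers through
   [q ^ (k - 1)] and [q ^ (n - k)] leaves an identity of rational functions. *)
have -> : q ^ n = q ^ (k - 1) * q * q ^ (n - k).
  by rewrite -[X in _ * X * _]expr1z -!expfzDr//; congr (_ ^ _); ring.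
have -> : q ^ k = q ^ (k - 1) * q.
  by rewrite -[X in _ * X]expr1z -!expfzDr//; congr (_ ^ _); ring.
have := qpoch_neq0 (k - 1) nz; have := qpoch_neq0 (n - k) nz.
have := nz (k - 1); have := nz (n - k).
move: (qpoch _ _ (k - 1)) (qpoch _ _ (n - k)) (qpoch _ _ n).
move: (q ^ (k - 1)) (q ^ (n - k)) => b c pk pm pn z1 z2 z3 z4.
by field; rewrite q0 z1 z2 z3 z4.
Qed.

(** * q-binomials in the limit a -> q: boundary values, symmetry, vanishing, Pascal rules *)

Section QBinomial.
Variables (K : fieldType) (q : K).
Hypotheses (q0 : q != 0) (qroot : forall m : nat, q ^+ m.+1 != 1).

Local Notation a := (('X : {poly K})%:F).
Local Notation q' := (q%:P%:F).
Local Notation P n := (qpoch a q' n).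

Lemma tends_to_pole_factor (e : nat) :
  tends_to ((1 - a / q') ^+ e) q (0 ^+ e).
Proof.
have := tends_to_poly ((1 - 'X * (q^-1)%:P) ^+ e) q.
rewrite tofracXn tofracB tofracM tofrac1 tofrac_polyCV.
by rewrite !hornerE divff// subrr.
Qed.

Lemma one_sub_Xq_neq0 (e : int) : 1 - a * q' ^ e != 0.
Proof.
rewrite subr_eq0 -tofrac_polyCXz -tofracM -tofrac1 tofrac_eq.
apply/eqP => /(congr1 (horner^~ 0)); rewrite !hornerE => /eqP.
by rewrite oner_eq0.
Qed.

(** Each factorial of negative index has a simple pole at a = q, so the exponent counts the zeros
    left over; [0 ^+ 0 = 1] covers the case of none. The index [m] is free because the correction
    term of the Pascal rule has [n + 1 - k] there. *)
Lemma qpoch_ratio_tends_to (n k m : int) :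
  ((n < 0)%R <= (k < 0)%R + (m < 0)%R)%N ->
  exists l, tends_to (P n / (P k * P m)) q
    (l * 0 ^+ ((k < 0)%R + (m < 0)%R - (n < 0)%R)).
Proof.
move=> le.
have [ln ln0 Hn] := qpoch_tends_to n q0 qroot.
have [lk lk0 Hk] := qpoch_tends_to k q0 qroot.
have [lm lm0 Hm] := qpoch_tends_to m q0 qroot.
exists (ln / (lk * lm)).
have u0 : 1 - a / q' != 0 by exact: (one_sub_Xq_neq0 (- 1)).
rewrite (pole_order_split _ _ _ u0 le).
apply: tends_toM (tends_to_pole_factor _); apply: tends_toM => //.
by apply: tends_toV; [exact: mulf_neq0 | exact: tends_toM].
Qed.

Lemma qbinomE (n k : int) (l : K) :
  tends_to (P n / (P k * P (n - k))) q l -> qbinom q n k = l.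
Proof. exact/tends_to_unique/qbinom_tends_to. Qed.

Lemma qbinom_sym (n k : int) : qbinom q n (n - k) = qbinom q n k.
Proof.
by apply: qbinomE; rewrite subKr [P (n - k) * _]mulrC; exact: qbinom_tends_to.
Qed.

Lemma qbinom_n0 (n : int) : qbinom q n 0 = 1.
Proof.
apply: qbinomE; rewrite /= big_nil mul1r subr0 divff; last first.
  by apply: qpoch_neq0; exact: one_sub_Xq_neq0.
by rewrite -tofrac1; exact: tends_to_polyC.
Qed.

Lemma qbinom_nn (n : int) : qbinom q n n = 1.
Proof. by rewrite -qbinom_sym subrr qbinom_n0. Qed.

(** More poles below than above leave a zero at a = q. This covers [k] outside [[0, n]] for
    [n >= 0], and [n < k < 0]. *)
Lemma qbinom_eq0 (n k : int) :
  ((n < 0)%R < (k < 0)%R + (n - k < 0)%R)%N -> qbinom q n k = 0.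
Proof.
move=> lt; apply: qbinomE; have [l] := qpoch_ratio_tends_to (ltnW lt).
by rewrite -subn_gt0 in lt; rewrite expr0n -[_ == 0%N]negbK -lt0n lt mulr0.
Qed.

(* As rational functions of [a] the two sides differ by
   q^(k-1) (q - a) (a;q)_n / ((a;q)_k (a;q)_(n+1-k)), and the ratio has a pole
   at a = q only for (n + 1, k) = (0, 0). *)
Lemma qbinom_pascal (n k : int) : (n + 1, k) != (0, 0) ->
  qbinom q (n + 1) k = qbinom q n (k - 1) + q ^ k * qbinom q n k.
Proof.
move=> nk.
have [|l Hl] := @qpoch_ratio_tends_to n k (n + 1 - k).
  move: nk; rewrite xpair_eqE.
  by case: (ltP n 0); case: (ltP k 0); case: (ltP (n + 1 - k) 0) => //; lia.
have := tends_toM (tends_to_polyC (- q ^ k) q)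
  (tends_toM (tends_to_pole_factor 1) Hl).
rewrite expr1 mul0r mulr0 => H0.
have := tends_toM (tends_to_polyC (q ^ k) q) (qbinom_tends_to n k q0 qroot).
move/(tends_toD (qbinom_tends_to n (k - 1) q0 qroot))/tends_toD/(_ H0).
rewrite addr0 => H; apply: qbinomE; move: H; congr (tends_to _ _ _).
rewrite polyCN tofracN tofrac_polyCXz mulNr; symmetry.
apply: qpoch_pascal; last exact: one_sub_Xq_neq0.
by rewrite tofrac_eq0 polyC_eq0.
Qed.

(** The reflection k -> n + 1 - k turns the first rule into this one and preserves the excluded
    pair. *)
Lemma qbinom_pascal_sym (n k : int) : (n + 1, k) != (0, 0) ->
  qbinom q (n + 1) k = q ^ (n + 1 - k) * qbinom q n (k - 1) + qbinom q n k.
Proof.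
move=> nk; rewrite -qbinom_sym qbinom_pascal; last first.
  by move: nk; rewrite !xpair_eqE; lia.
rewrite addrC -[qbinom q n (k - 1)]qbinom_sym -[qbinom q n k]qbinom_sym.
by congr (_ * qbinom _ _ _ + qbinom _ _ _); ring.
Qed.

End QBinomial.

(** * Algebra of the twisted product of formal series *)

Section Coefficients.
Variables (K : fieldType) (q : K).
Hypothesis q0 : q != 0.
Implicit Types (e c d n k : int) (u v s : int * int) (f g h : int * int -> K).

(** A sum with infinite support is 0 by convention, so additivity rests on a finite set containing
    both supports. *)
Lemma fsumD (T : choiceType) (F G : T -> K) :
  finite_set [set t | F t != 0] -> finite_set [set t | G t != 0] ->
  \sum_(t \in [set: T]) (F t + G t) =
  \sum_(t \in [set: T]) F t + \sum_(t \in [set: T]) G t.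
Proof.
move=> finF finG; set A := [set t | F t != 0] `|` [set t | G t != 0].
have finA : finite_set A by rewrite finite_setU.
have A0 t : ~ A t -> F t = 0 /\ G t = 0.
  by move=> /not_orP[] /negP/negPn/eqP ? /negP/negPn/eqP ?.
rewrite -!(@fsbig_widen _ _ _ _ A setT) ?fsbig_split//.
- by move=> t [_ /A0[]].
- by move=> t [_ /A0[]].
- by move=> t [_ /A0[/= -> ->]]; rewrite addr0.
Qed.

(** Exponents bounded on the same side make every coefficient a finite sum, so [fsumD] applies. *)
Lemma qmulDl e c c' c'' d d' d'' f g h : e = 1 \/ e = - 1 ->
  hom_from e c d f -> hom_from e c' d' g -> hom_from e c'' d'' h ->
  qmul q (fun s => f s + g s) h = (fun s => qmul q f h s + qmul q g h s).
Proof.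
move=> e1 Hf Hg Hh; apply/funext => s; rewrite /qmul -fsumD.
- by apply: eq_fsbigr => t _; rewrite !mulrDl.
- exact: qmul_finite_support e1 Hf Hh.
- exact: qmul_finite_support e1 Hg Hh.
Qed.

Lemma qmulDr e c c' c'' d d' d'' f g h : e = 1 \/ e = - 1 ->
  hom_from e c d f -> hom_from e c' d' g -> hom_from e c'' d'' h ->
  qmul q h (fun s => f s + g s) = (fun s => qmul q h f s + qmul q h g s).
Proof.
move=> e1 Hf Hg Hh; apply/funext => s; rewrite /qmul -fsumD.
- by apply: eq_fsbigr => t _; rewrite mulrDr mulrDl.
- exact: qmul_finite_support e1 Hh Hf.
- exact: qmul_finite_support e1 Hh Hg.
Qed.

(** A monomial only shifts and rescales coefficients, so both sides are the same sum after t -> t +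
    u. *)
Lemma qmulA_monol u f g :
  qmul q (qmono K u) (qmul q f g) = qmul q (qmul q (qmono K u) f) g.
Proof.
apply/funext => s; rewrite qmul_monol /qmul mulr_fsuml.
rewrite [RHS](reindex_fsbigT (fun t : int * int => t + u)); last first.
  by exists (fun t => t - u) => t; rewrite (addrK, subrK).
apply: eq_fsbigr => t _; rewrite -/(qmul q _ f _) qmul_monol addrK.
rewrite opprD [- t - u]addrC addrA [X in _ = X * _]mulrAC -!mulrA.
congr (_ * (_ * _)); rewrite -!expfzDr//.
by congr (_ ^ _); rewrite /=; ring.
Qed.

Lemma qmulA_monor u f g :
  qmul q (qmul q f g) (qmono K u) = qmul q f (qmul q g (qmono K u)).
Proof.
apply/funext => s; rewrite qmul_monor /qmul mulr_fsuml.
apply: eq_fsbigr => t _; rewrite -/(qmul q g _ _) qmul_monor.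
rewrite -!mulrA; congr (_ * _); rewrite [s - t - u]addrAC; congr (_ * _).
by rewrite -!expfzDr//; congr (_ ^ _); rewrite /=; ring.
Qed.

Lemma qmul1 f : qmul q (qmono K (0, 0)) f = f.
Proof.
apply/funext => s; rewrite qmul_monol /= mul0r expr0z mulr1.
by case: s => s1 s2; congr (f (_, _)); rewrite /= subr0.
Qed.

Lemma qmulr1 f : qmul q f (qmono K (0, 0)) = f.
Proof.
apply/funext => s; rewrite qmul_monor /= mulr0 expr0z mulr1.
by case: s => s1 s2; congr (f (_, _)); rewrite /= subr0.
Qed.

(** The outer factor of interest is x + y; distributivity reduces this case of associativity to
    monomials. *)
Lemma qmulA_addl e c c' d d' u v f g : e = 1 \/ e = - 1 ->
  hom_from e c d f -> hom_from e c' d' g ->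
  qmul q (qmono K u + qmono K v) (qmul q f g) =
  qmul q (qmul q (qmono K u + qmono K v) f) g.
Proof.
move=> e1 Hf Hg; have Hw w := qmul_hom_from (q := q) (@qmono_hom_from K e w) Hf.
rewrite [qmul q (_ + _) f](_ : _ = fun s =>
  qmul q (qmono K u) f s + qmul q (qmono K v) f s); last first.
  by apply/funext => s; rewrite qmul_addl.
rewrite (qmulDl e1 (Hw u) (Hw v) Hg) -!qmulA_monol.
by apply/funext => s; rewrite qmul_addl.
Qed.

Lemma qmulA_addr e c c' d d' u v f g : e = 1 \/ e = - 1 ->
  hom_from e c d f -> hom_from e c' d' g ->
  qmul q (qmul q f g) (qmono K u + qmono K v) =
  qmul q f (qmul q g (qmono K u + qmono K v)).
Proof.
move=> e1 Hf Hg; have Hw w := qmul_hom_from (q := q) Hg (@qmono_hom_from K e w).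
rewrite [qmul q g (_ + _)](_ : _ = fun s =>
  qmul q g (qmono K u) s + qmul q g (qmono K v) s); last first.
  by apply/funext => s; rewrite qmul_addr.
rewrite (qmulDr e1 (Hw u) (Hw v) Hf) -!qmulA_monor.
by apply/funext => s; rewrite qmul_addr.
Qed.

(** For [n < 0] the factor x + y cancels the leftmost copy of its right inverse. *)
Lemma xy_pow_up_succ n :
  xy_pow_up q (n + 1) = qmul q (qx K + qy K) (xy_pow_up q n).
Proof.
case: n => m; first by rewrite (_ : Posz m + 1 = Posz m.+1); last by lia.
have H1 : hom_from 1 0 (- 1) (inv_xy_up q).
  have := @xy_pow_up_hom_from K q (- 1) isT.
  by rewrite /xy_pow_up /qexp /= qmulr1.
have -> : xy_pow_up q (Negz m + 1) = qexp q (inv_xy_up q) m.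
  by case: m => // m; rewrite (_ : Negz m.+1 + 1 = Negz m) //; lia.
rewrite /xy_pow_up /qexp iterS -/(qexp _ _ _).
have Hm := qexp_hom_from (q := q) (m := m) H1.
by rewrite (qmulA_addl _ _ (or_introl erefl) H1 Hm) inv_xy_upP// qmul1.
Qed.

(** [qexp] adds factors on the left while x + y cancels on the right, so an induction carries x + y
    to the innermost factor. *)
Lemma xy_pow_down_succ n : n < 0 ->
  xy_pow_down q (n + 1) = qmul q (xy_pow_down q n) (qx K + qy K).
Proof.
case: n => // m _.
have H1 : hom_from (- 1) (- 1) (- 1) (inv_xy_down q).
  have := @xy_pow_down_hom_from K q (- 1) isT.
  by rewrite /xy_pow_down /qexp /= qmulr1.
have -> : xy_pow_down q (Negz m + 1) = qexp q (inv_xy_down q) m.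
  by case: m => // m; rewrite (_ : Negz m.+1 + 1 = Negz m) //; lia.
elim: m => [|m IH]; first by rewrite /= /qexp /= qmulr1 inv_xy_downP.
rewrite /xy_pow_down /qexp iterS -/(qexp _ _ _).
have Hm := qexp_hom_from (q := q) (m := m.+1) H1.
rewrite (qmulA_addr _ _ (or_intror erefl) H1 Hm).
by rewrite -[qmul _ (qexp _ _ _) _]IH.
Qed.

(** Carrying y past x^k produces the factor [q ^ k]. *)
Lemma qmul_xy_coefl f n k :
  qmul q (qx K + qy K) f (k, n + 1 - k) =
  f (k - 1, n - (k - 1)) + q ^ k * f (k, n - k).
Proof.
rewrite qmul_addl !qmul_monol /= mul0r mul1r expr0z mulr1 [q ^ _ * _]mulrC.
by congr (f (_, _) + f (_, _) * q ^ _); rewrite /=; ring.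
Qed.

Lemma qmul_xy_coefr f n k :
  qmul q f (qx K + qy K) (k, n + 1 - k) =
  q ^ (n + 1 - k) * f (k - 1, n - (k - 1)) + f (k, n - k).
Proof.
rewrite qmul_addr !qmul_monor /= mulr0 mulr1 expr0z mulr1 [q ^ _ * _]mulrC.
by congr (f (_, _) * q ^ _ + f (_, _)); rewrite /=; ring.
Qed.

(** * Comparison of q-binomials with coefficients *)

Hypothesis qroot : forall m : nat, q ^+ m.+1 != 1.

Lemma qbinom_nneg (m : nat) k :
  qbinom q m k = qexp q (qx K + qy K) m (k, m%:Z - k).
Proof.
elim: m k => [|m IH] k.
  rewrite /qexp /= /qmono xpair_eqE; have [->|k0] := eqVneq k 0.
    by rewrite qbinom_n0.
  by rewrite qbinom_eq0//; case: (ltP k 0); case: (ltP (0 - k) 0) => //; lia.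
rewrite (_ : Posz m.+1 = m%:Z + 1); last by lia.
rewrite qbinom_pascal//; last by rewrite xpair_eqE; lia.
by rewrite /qexp iterS -/(qexp _ _ _) qmul_xy_coefl !IH.
Qed.

Lemma qbinom_up (m j : nat) :
  qbinom q (- m%:Z) j = xy_pow_up q (- m%:Z) (j%:Z, - m%:Z - j%:Z).
Proof.
elim: m j => [|m IHm] j; first exact: qbinom_nneg.
have nE : - m.+1%:Z + 1 = - m%:Z by lia.
have rec k := qmul_xy_coefl (xy_pow_up q (- m.+1%:Z)) (- m.+1%:Z) k.
elim: j => [|j IHj].
  rewrite qbinom_n0//; have := rec 0; rewrite -xy_pow_up_succ nE -IHm qbinom_n0//.
  (* The ascending expansion has no term in x^(-1). *)
  rewrite expr0z mul1r [X in _ = X + _ -> _](_ : _ = 0) ?add0r//.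
  by apply/eqP/negPn/negP => /xy_pow_up_hom_from[].
(* The row above and the entry at [j] determine [q ^ (j + 1)] times the entry at [j + 1]; this power
   is then cancelled. *)
have := rec j.+1%:Z; rewrite -xy_pow_up_succ nE -IHm -nE.
rewrite qbinom_pascal//; last by rewrite xpair_eqE; lia.
rewrite (_ : j.+1%:Z - 1 = j%:Z); last by lia.
by rewrite IHj => /addrI/mulfI; apply; rewrite expfz_neq0.
Qed.

Lemma qbinom_down (m : nat) k : k <= - m%:Z ->
  qbinom q (- m%:Z) k = xy_pow_down q (- m%:Z) (k, - m%:Z - k).
Proof.
elim: m k => [|m IHm] k; first by move=> _; exact: qbinom_nneg.
set n := - m.+1%:Z; have nE : n + 1 = - m%:Z by rewrite /n; lia.
have n0 : n < 0 by [].
have rec i : i <= n + 1 -> qbinom q (n + 1) i =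
    q ^ (n + 1 - i) * xy_pow_down q n (i - 1, n - (i - 1)) +
    xy_pow_down q n (i, n - i).
  rewrite nE => /IHm ->.
  by rewrite -[in LHS]nE xy_pow_down_succ// qmul_xy_coefr nE.
move=> kn; have [j ->] : exists j : nat, k = n - j%:Z.
  by exists (absz (n - k)); lia.
elim: j {k kn} => [|j IHj].
  rewrite subr0 qbinom_nn//; have := rec (n + 1) (lexx _).
  rewrite qbinom_nn// addrK !subrr expr0z mul1r.
  (* The entry at [n + 1] vanishes: the descending expansion stops at x^n. *)
  rewrite [X in _ = _ + X -> _](_ : _ = 0) ?addr0//.
  by apply/eqP/negPn/negP => /(xy_pow_down_hom_from n0)[/=]; lia.
have := rec (n - j%:Z); rewrite (_ : n - j.+1%:Z = n - j%:Z - 1); last by lia.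
rewrite qbinom_pascal_sym//; last by rewrite xpair_eqE; lia.
rewrite IHj => /(_ ltac:(lia)) /addIr/mulfI; apply.
by rewrite expfz_neq0.
Qed.

Lemma qbinom_xy_coef n k : qbinom q n k = xy_coef q n k.
Proof.
rewrite /xy_coef; case: n => m; first by rewrite qbinom_nneg; case: ifP.
rewrite NegzE; case: k => k /=; first exact: qbinom_up.
have [kn|kn] := leP (Negz k) (- m.+1%:Z); first exact: qbinom_down.
rewrite qbinom_eq0//; last by lia.
(* For [n < k < 0], [xy_coef] reads the descending expansion beyond its top exponent [n]. *)
apply/esym/eqP/negPn/negP => /(@xy_pow_down_hom_from K q (- m.+1%:Z) isT)[/=].
by lia.
Qed.

End Coefficients.

Theorem theorem5p4 (n k : int) : qbinom qvar n k = xy_coef qvar n k.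
Proof. exact: qbinom_xy_coef qvar_neq0 qvar_expS_neq1 n k. Qed.
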